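(* Let $m\ge1$, let $X$ be a set and let $\mathfrak D^m(X)$ be the free $\mathrm{Dyck}^m$ algebra over $X$. For every integer $0\le k<m$, the image $\mathbb S_k(\mathfrak D^m(X))$ of $\mathfrak D^m(X)$ under the functor $\mathbb S_k$ is a free $\mathrm{Dyck}^{m-1}$ algebra.
   Context: $\mathbb K$ is a field. For $m\ge0$, a $\mathrm{Dyck}^m$ algebra is a $\mathbb K$-vector space $D$ with bilinear operations $*_0,\dots,*_m$ such that for all $x,y,z\in D$: (1) $x*_i(y*_jz)=(x*_iy)*_jz$ for $0\le i<j\le m$; (2) $\sum_{j=0}^i x*_i(y*_jz)=\sum_{k=i}^m (x*_ky)*_iz$ for $0\le i\le m$. (For $m=0$ this is an associative algebra.) For a $\mathrm{Dyck}^m$ algebra $(D,*_0,\dots,*_m)$ and $0\le k\le m-1$, $\mathbb S_k(D)$ is the $\mathrm{Dyck}^{m-1}$ algebra with the same underlying space and products $\overline *_j=*_j$ for $0\le j<k$, $\overline *_k=*_k+*_{k+1}$, and $\overline *_j=*_{j+1}$ for $k<j\le m-1$. *)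

(* Defs.v *)
From HB Require Import structures.
From mathcomp Require Import all_boot all_order all_algebra.
From mathcomp Require Import zify.

Set Implicit Arguments.
Unset Strict Implicit.
Unset Printing Implicit Defensive.

Import GRing.Theory.
Local Open Scope ring_scope.

(* The operations are indexed by 'I_m.+1 = {0, ..., m}; no unit is required,
   so that dyckAlg K 0 is the type of nonunital associative K-algebras. *)
Record dyckAlg (K : fieldType) (m : nat) := DyckAlg {
  dyck_sort :> lmodType K;
  dyck_op : 'I_m.+1 -> dyck_sort -> dyck_sort -> dyck_sort;
  dyck_bilinear : forall i, bilinear_for *:%R *:%R (dyck_op i);
  dyck_assoc : forall (i j : 'I_m.+1) (x y z : dyck_sort), (i < j)%N ->
    dyck_op i x (dyck_op j y z) = dyck_op j (dyck_op i x y) z;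
  dyck_sum : forall (i : 'I_m.+1) (x y z : dyck_sort),
    \sum_(j < m.+1 | (j <= i)%N) dyck_op i x (dyck_op j y z)
    = \sum_(k < m.+1 | (i <= k)%N) dyck_op i (dyck_op k x y) z
}.

Definition dyck_hom (K : fieldType) (m : nat) (A B : dyckAlg K m)
    (f : A -> B) : Prop :=
  linear f /\ forall (i : 'I_m.+1) (x y : A),
    f (dyck_op i x y) = dyck_op i (f x) (f y).

Definition dyck_free_over (K : fieldType) (m : nat) (X : Type)
    (D : dyckAlg K m) (iota : X -> D) : Prop :=
  forall (A : dyckAlg K m) (f : X -> A),
    exists phi : D -> A,
      [/\ dyck_hom phi,
          forall x, phi (iota x) = f x
        & forall psi : D -> A, dyck_hom psi ->
            (forall x, psi (iota x) = f x) -> psi =1 phi].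

Definition dyck_free (K : fieldType) (m : nat) (D : dyckAlg K m) : Prop :=
  exists (Y : Type) (iota : Y -> D), dyck_free_over iota.

Lemma bilinear_suml (K : fieldType) (V : lmodType K) (f : V -> V -> V) :
  bilinear_for *:%R *:%R f ->
  forall (I : finType) (P : pred I) (F : I -> V) (y : V),
    f (\sum_(i | P i) F i) y = \sum_(i | P i) f (F i) y.
Proof.
move=> [l _] I P F y.
have fD u v : f (u + v) y = f u y + f v y.
  by have := l y 1 u v; rewrite /= !scale1r.
apply: (big_morph (f^~ y) fD).
by apply: (@addrI _ (f 0 y)); rewrite -fD !addr0.
Qed.

Lemma bilinear_sumr (K : fieldType) (V : lmodType K) (f : V -> V -> V) :
  bilinear_for *:%R *:%R f ->
  forall (I : finType) (P : pred I) (F : I -> V) (x : V),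
    f x (\sum_(i | P i) F i) = \sum_(i | P i) f x (F i).
Proof.
move=> [_ r] I P F x.
have fD u v : f x (u + v) = f x u + f x v.
  by have := r x 1 u v; rewrite /= !scale1r.
apply: (big_morph (f x) fD).
by apply: (@addrI _ (f x 0)); rewrite -fD !addr0.
Qed.

Section SumConsecutive.
Variables (K : fieldType) (m : nat) (D : dyckAlg K m.+1) (k : 'I_m.+1).

(* For j : 'I_m.+1, the indices j and j + 1 of 'I_m.+2 are
   widen_ord (leqnSn m.+1) j and lift ord0 j. *)
Definition dyckS_op (j : 'I_m.+1) (x y : D) : D :=
  if (j < k)%N then dyck_op (widen_ord (leqnSn m.+1) j) x y
  else if j == k then
    dyck_op (widen_ord (leqnSn m.+1) k) x y + dyck_op (lift ord0 k) x y
  else dyck_op (lift ord0 j) x y.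

Lemma dyckS_bilinear (j : 'I_m.+1) : bilinear_for *:%R *:%R (dyckS_op j).
Proof.
rewrite /dyckS_op; case: ltnP => _; first exact: dyck_bilinear.
case: eqP => _; last exact: dyck_bilinear.
have [l1 r1] := dyck_bilinear D (widen_ord (leqnSn m.+1) k).
have [l2 r2] := dyck_bilinear D (lift ord0 k).
split=> u a v w /=.
  by have /= -> := l1 u a v w; have /= -> := l2 u a v w; rewrite scalerDr addrACA.
by have /= -> := r1 u a v w; have /= -> := r2 u a v w; rewrite scalerDr addrACA.
Qed.

Let opDl i (x y z : D) : dyck_op i (x + y) z = dyck_op i x z + dyck_op i y z.
Proof.
by have [l _] := dyck_bilinear D i; have := l z 1 x y; rewrite /= !scale1r.
Qed.

Let opDr i (x y z : D) : dyck_op i x (y + z) = dyck_op i x y + dyck_op i x z.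
Proof.
by have [_ r] := dyck_bilinear D i; have := r x 1 y z; rewrite /= !scale1r.
Qed.

Let sum_op (P : pred 'I_m.+1) (Q : pred 'I_m.+2) (x y : D) :
  (forall j : 'I_m.+1, (j <= k)%N -> Q (widen_ord (leqnSn m.+1) j) = P j) ->
  (forall j : 'I_m.+1, (k <= j)%N -> Q (lift ord0 j) = P j) ->
  \sum_(j < m.+1 | P j) dyckS_op j x y = \sum_(j < m.+2 | Q j) dyck_op j x y.
Proof.
move=> Qw Ql.
rewrite [RHS](bigID (fun j : 'I_m.+2 => (j <= k)%N)) /=.
rewrite [X in _ = X + _]big_mkcond [X in _ = X + _]big_ord_recr /=.
rewrite [X in _ = _ + X]big_mkcond [X in _ = _ + X]big_ord_recl /=.
rewrite ltn_geF ?ltn_ord // andbF addr0 andbF add0r.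
rewrite -big_split big_mkcond /=; apply: eq_bigr => j _.
rewrite /dyckS_op /bump /= add1n -ltnNge ltnS.
case: (ltngtP j k) => [jk|kj|jk].
- by rewrite Qw ?(ltnW jk) // andbT andbF addr0.
- by rewrite Ql ?(ltnW kj) // andbF andbT add0r -val_eqE /= gtn_eqF.
- rewrite Qw ?Ql ?jk // !andbT.
  have -> : j = k by apply: val_inj.
  by rewrite eqxx; case: ifP; rewrite ?addr0.
Qed.

Lemma dyckS_assoc (i j : 'I_m.+1) (x y z : D) : (i < j)%N ->
  dyckS_op i x (dyckS_op j y z) = dyckS_op j (dyckS_op i x y) z.
Proof.
move=> ij; rewrite /dyckS_op -!val_eqE /=.
have A (a b : 'I_m.+2) : (a < b)%N ->
  dyck_op a x (dyck_op b y z) = dyck_op b (dyck_op a x y) z by exact: dyck_assoc.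
case: (ltngtP i k) => ik; case: (ltngtP j k) => jk; rewrite ?opDl ?opDr;
  solve [ exfalso; lia | by rewrite !A //= /bump /=; lia ].
Qed.

Lemma dyckS_sum (i : 'I_m.+1) (x y z : D) :
  \sum_(j < m.+1 | (j <= i)%N) dyckS_op i x (dyckS_op j y z)
  = \sum_(l < m.+1 | (i <= l)%N) dyckS_op i (dyckS_op l x y) z.
Proof.
rewrite -(bilinear_sumr (dyckS_bilinear i)) -(bilinear_suml (dyckS_bilinear i)).
pose Sr (a : 'I_m.+2) := \sum_(j < m.+2 | (j <= a)%N) dyck_op j y z.
pose Sl (a : 'I_m.+2) := \sum_(l < m.+2 | (a <= l)%N) dyck_op l x y.
have S a : dyck_op a x (Sr a) = dyck_op a (Sl a) z.
  rewrite (bilinear_sumr (dyck_bilinear D a)) (bilinear_suml (dyck_bilinear D a)).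
  exact: dyck_sum.
pose w := widen_ord (leqnSn m.+1); pose s := @lift m.+2 ord0.
have Sr_s : Sr (s k) = Sr (w k) + dyck_op (s k) y z.
  rewrite /Sr (bigD1 (s k)) ?leqnn //= addrC; congr (_ + _).
  apply: eq_bigl => j; rewrite -val_eqE /= /bump /= add1n.
  by rewrite andbC -ltn_neqAle ltnS.
have Sl_w : Sl (w k) = dyck_op (w k) x y + Sl (s k).
  rewrite /Sl (bigD1 (w k)) ?leqnn //=; congr (_ + _).
  apply: eq_bigl => j; rewrite -val_eqE /= /bump /= add1n.
  by rewrite ltn_neqAle eq_sym andbC.
have sumr (a : 'I_m.+2) : (a = i + (k <= i) :> nat)%N ->
    \sum_(j < m.+1 | (j <= i)%N) dyckS_op j y z = Sr a.
  by move=> ea; apply: sum_op => j ?; rewrite /= ?/bump ea; lia.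
have suml (a : 'I_m.+2) : (a = i + (k < i) :> nat)%N ->
    \sum_(l < m.+1 | (i <= l)%N) dyckS_op l x y = Sl a.
  by move=> ea; apply: sum_op => j ?; rewrite /= ?/bump ea; lia.
case: (ltngtP i k) => ik.
- rewrite (sumr (w i)) ?(suml (w i)) /dyckS_op /= ?ik; [exact: S|lia|lia].
- rewrite (sumr (s i)) ?(suml (s i)) /dyckS_op /= /bump /= ?ik; [|lia|lia].
  by rewrite ltnNge (ltnW ik) -val_eqE /= gtn_eqF //; exact: S.
- rewrite (sumr (s k)) ?(suml (w k)) /dyckS_op /= /bump /= ?ik; [|lia|lia].
  rewrite ltnn -val_eqE /= ik eqxx -/(w k) -/(s k) S [in LHS]Sr_s [in RHS]Sl_w.
  rewrite opDr !opDl S Sl_w !opDl -!addrA; congr (_ + (_ + _)).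
  by rewrite dyck_assoc //= /bump /= add1n.
Qed.

Definition dyckS : dyckAlg K m := DyckAlg dyckS_bilinear dyckS_assoc dyckS_sum.

End SumConsecutive.

(* Main.v *)
Require Import Defs.
From HB Require Import structures.
From mathcomp Require Import all_boot all_order all_algebra.
From mathcomp Require Import zify.
From mathcomp Require Import boolp finmap monalg.

Set Implicit Arguments.
Unset Strict Implicit.
Unset Printing Implicit Defensive.

Import GRing.Theory.
Local Open Scope ring_scope.

(** Orient the defining relations so that [x *_i (y *_j z)] is rewritten
   whenever [i <= j].  The irreducible products are spelled by the normal trees:
   the right factor of an operation [i] is a leaf or has its root below [i].
   The rewriting is confluent, in the strong sense that it makes the vector
   space on all trees, normal or not, into a Dyck algebra ([tree_alg]), where
   every normal tree is its own value ([eval_normal]) and from which evaluation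
   into any Dyck algebra is multiplicative ([evalM_mul]).  It follows that
   normal trees in the generators form a basis of a free Dyck algebra, and
   conversely that an algebra is free over a family as soon as the normal trees
   in that family form a basis ([free_of_normal_basis]).

   So the point is to find in [D] a family whose normal trees, spelled with the
   merged operations, form a basis.  Besides the generators of [D], the merged
   algebra needs new ones, for the products by [*_k] itself.  If [i < k] then
   [(d *_i g) *_k r = d *_i (g *_k r)] is a merged product involving
   [g *_k r], and the relations also rewrite [g *_k r] when the root of [r] is
   at least [k].  What is left ([generator]) are the [g *_k r] with [r] normal
   of root below [k] and [g] normal without left factor below [k] to pull out.

   These elements generate, by induction on the number of leaves
   ([normal_reached]).  For independence, expand a normal tree in the merged
   operations into trees over the original generators.  Its leading tree
   ([lead]) is obtained by choosing the operation [k.+1] for the merged one, and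
   by sliding the left factors below [k] of a generator [g *_k r] back into [g].
   All other terms are lighter ([eval_leads]), the weight of a tree being the
   number of leaves found on the right of its operations [k.+1], counted with
   multiplicity; and the leading tree determines the tree it comes from
   ([lead_inj]). *)

(** * Linear algebra on a free vector space *)

(** A vector space with a basis, described abstractly: linear maps may be
   prescribed on the basis, and every vector is a finite combination of basis
   vectors, whose coefficients are the values of the extended indicator
   functions. *)
Record freeSpace (K : fieldType) (T : choiceType) := FreeSpace {
  free_sort :> lmodType K;
  basis : T -> free_sort;
  lext : forall V : lmodType K, (T -> V) -> free_sort -> V;
  support : free_sort -> seq T;
  lextP : forall (V : lmodType K) (f : T -> V) a u v,
    lext f (a *: u + v) = a *: lext f u + lext f v;
  lext_basis : forall (V : lmodType K) (f : T -> V) t, lext f (basis t) = f t;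
  support_uniq : forall u, uniq (support u);
  lextE : forall (V : lmodType K) (f : T -> V) u,
    lext f u = \sum_(t <- support u) lext (fun s => (s == t)%:R : K^o) u *: f t;
  lext_basis_id : forall u, lext basis u = u
}.

Section FreeSpaceExists.
Variables (K : fieldType) (T : choiceType).
Implicit Types (u v : {malg K[T]}) (V : lmodType K).

Let bas (t : T) : {malg K[T]} := << 1 *g t >>.

Let ext V (f : T -> V) u : V := \sum_(t <- msupp u) u@_t *: f t.

Let extEw V (f : T -> V) u (d : {fset T}) : (msupp u `<=` d)%fset ->
  ext f u = \sum_(t <- d) u@_t *: f t.
Proof.
move=> le; rewrite /ext (big_fset_incl _ le) //= => t _.
by move/mcoeff_outdom ->; rewrite scale0r.
Qed.

Let extP V (f : T -> V) a u v : ext f (a *: u + v) = a *: ext f u + ext f v.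
Proof.
pose d := (msupp u `|` msupp v)%fset.
have leu : (msupp u `<=` d)%fset by exact: fsubsetUl.
have lev : (msupp v `<=` d)%fset by exact: fsubsetUr.
rewrite (@extEw _ f (a *: u + v) d) ?(extEw f leu) ?(extEw f lev); last first.
  apply: fsubset_trans (msuppD_le _ _) _; apply: fsetSU; exact: msuppZ_le.
rewrite scaler_sumr -big_split; apply: eq_bigr => t _.
by rewrite mcoeffD mcoeffZ scalerDl scalerA.
Qed.

Let ext_bas V (f : T -> V) t : ext f (bas t) = f t.
Proof. by rewrite /ext /bas msuppU oner_eq0 /= big_seq_fset1 mcoeffUU scale1r. Qed.

Let ext_coord u t : ext (fun s => (s == t)%:R : K^o) u = u@_t.
Proof.
rewrite /ext; case: (boolP (t \in msupp u)) => tu.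
  rewrite (big_rem t) //= eqxx big1_seq ?addr0 ?[LHS]mulr1 // => s /andP[_].
  by rewrite mem_rem_uniq ?fset_uniq // inE => /andP[/negPf -> _]; rewrite scaler0.
rewrite big1_seq ?mcoeff_outdom // => s /andP[_ su].
by case: eqP => [st|_]; [case/negP: tu; rewrite -st|rewrite scaler0].
Qed.

Let ext_bas_id u : ext bas u = u.
Proof.
rewrite [RHS]monalgE /ext; apply: eq_bigr => t _; apply/malgP => s.
by rewrite mcoeffZ /bas !mcoeffU; case: eqP => _; rewrite ?mulr1 ?mulr0.
Qed.

Lemma free_space : freeSpace K T.
Proof.
exists {malg K[T]} bas ext (fun u => msupp u) => // V f u.
by apply: eq_bigr => t _; rewrite ext_coord.
Qed.

End FreeSpaceExists.

Section FreeSpaceTheory.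
Variables (K : fieldType) (T : choiceType) (M : freeSpace K T).
Implicit Types (P Q : T -> Prop) (u v : M) (V : lmodType K).

HB.instance Definition _ V (f : T -> V) :=
  GRing.isLinear.Build K M V *:%R (lext f) (lextP f).

Lemma lext0 V (f : T -> V) : lext f (0 : M) = 0.
Proof. exact: raddf0. Qed.

Definition coefficient t u : K := lext (fun s => (s == t)%:R : K^o) u.

(** Inductive rather than a condition on the coefficients, so that any property
   stable under linear combinations can be proved by induction on it. *)
Inductive inspan P : M -> Prop :=
| InSpan0 : inspan P 0
| InSpanP a t u : P t -> inspan P u -> inspan P (a *: basis M t + u).

Lemma coefficientP a u v t :
  coefficient t (a *: u + v) = a * coefficient t u + coefficient t v.
Proof. by rewrite /coefficient lextP. Qed.

Lemma coefficient_basis s t : coefficient t (basis M s) = (s == t)%:R.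
Proof. by rewrite /coefficient lext_basis. Qed.

Lemma coefficient_sum (I : Type) (r : seq I) (F : I -> M) (a : I -> K) t :
  coefficient t (\sum_(i <- r) a i *: F i) = \sum_(i <- r) a i * coefficient t (F i).
Proof.
elim: r => [|i r IH]; first by rewrite !big_nil /coefficient lext0.
by rewrite !big_cons coefficientP IH.
Qed.

Lemma span_support u : u = \sum_(t <- support u) coefficient t u *: basis M t.
Proof. by rewrite -{1}[u]lext_basis_id lextE. Qed.

Lemma basis_ind (Q : M -> Prop) :
  Q 0 -> (forall a u v, Q u -> Q v -> Q (a *: u + v)) ->
  (forall t, Q (basis M t)) -> forall u, Q u.
Proof.
move=> Q0 QD Qb u; rewrite [u]span_support.
by elim/big_rec: _ => // t v _ Qv; apply: QD.
Qed.

Lemma inspanP P a u v : inspan P u -> inspan P v -> inspan P (a *: u + v).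
Proof.
move=> Pu Pv; elim: Pu => [|c t w Pt _ IH]; first by rewrite scaler0 add0r.
by rewrite scalerDr scalerA -addrA; constructor.
Qed.

Lemma inspanD P u v : inspan P u -> inspan P v -> inspan P (u + v).
Proof. by move=> Pu Pv; rewrite -[u]scale1r; exact: inspanP. Qed.

Lemma inspanB P u v : inspan P u -> inspan P v -> inspan P (u - v).
Proof. by move=> Pu Pv; rewrite addrC -scaleN1r; exact: inspanP. Qed.

Lemma inspan_sum P (I : finType) (p : pred I) (F : I -> M) :
  (forall i, p i -> inspan P (F i)) -> inspan P (\sum_(i | p i) F i).
Proof.
move=> PF; elim/big_rec: _ => [|i v pi Pv]; first by constructor.
by apply: inspanD => //; exact: PF.
Qed.

Lemma inspan_basis P t : P t -> inspan P (basis M t).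
Proof.
move=> Pt; rewrite -[basis M t]addr0 -[basis M t]scale1r.
by constructor=> //; constructor.
Qed.

Lemma inspanT u : inspan (fun=> True) u.
Proof.
move: u; apply: basis_ind => [|a u v Pu Pv|t]; first by constructor.
  exact: inspanP.
exact: inspan_basis.
Qed.

Lemma inspan_sub P Q u : (forall t, P t -> Q t) -> inspan P u -> inspan Q u.
Proof. by move=> PQ; elim=> [|a t v Pt _ IH]; constructor=> //; exact: PQ. Qed.

Lemma inspan_coefficient0 P u t : inspan P u -> ~ P t -> coefficient t u = 0.
Proof.
move=> Pu nPt; elim: Pu => [|a s v Ps _ IH]; first by rewrite /coefficient lext0.
rewrite coefficientP coefficient_basis IH addr0; case: eqP => [st|_]; last by rewrite mulr0.
by case: nPt; rewrite -st.
Qed.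

Lemma inspan_and P Q u :
  inspan P u -> inspan Q u -> inspan (fun t => P t /\ Q t) u.
Proof.
move=> Pu Qu; rewrite [u]span_support; elim: (support u) => [|t s IH].
  by rewrite big_nil; constructor.
rewrite big_cons; have [->|nz] := eqVneq (coefficient t u) 0; first by rewrite scale0r add0r.
constructor=> //; split; apply: contrapT => H.
  by move: nz; rewrite (inspan_coefficient0 Pu H) eqxx.
by move: nz; rewrite (inspan_coefficient0 Qu H) eqxx.
Qed.

(** A vector on which a triangular system of functionals vanishes is zero: the
   functional of an index of largest weight only sees that index. *)
Lemma triangular_zero (w : T -> nat) (L : T -> T -> K) u :
  (forall t s, coefficient s u != 0 -> (w s <= w t)%N -> L t s = (s == t)%:R) ->
  (forall t, \sum_(s <- support u) coefficient s u * L t s = 0) -> u = 0.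
Proof.
move=> tri vanish.
have heaviest (r : seq T) : {in r, forall s, coefficient s u = 0} \/
    exists2 t, t \in r & coefficient t u != 0 /\
      {in r, forall s, coefficient s u != 0 -> (w s <= w t)%N}.
  elim: r => [|s r IH]; first by left.
  have [s0|s_nz] := eqVneq (coefficient s u) 0.
    case: IH => [r0|[t tr [t_nz tmax]]].
      by left=> x; rewrite inE => /predU1P[->|/r0].
    right; exists t; first by rewrite inE tr orbT.
    by split=> // x; rewrite inE => /predU1P[->|/tmax]; rewrite ?s0 ?eqxx.
  right; case: IH => [r0|[t tr [t_nz tmax]]].
    exists s; first exact: mem_head.
    by split=> // x; rewrite inE => /predU1P[->|/r0 ->]; rewrite ?eqxx.
  case: (leqP (w s) (w t)) => st.
    exists t; first by rewrite inE tr orbT.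
    by split=> // x; rewrite inE => /predU1P[->|/tmax].
  exists s; first exact: mem_head.
  split=> // x; rewrite inE => /predU1P[-> //|/tmax xt /xt /leq_trans]; apply.
  exact: ltnW.
case: (heaviest (support u)) => [s0|[t tu [t_nz tmax]]].
  by rewrite [u]span_support big1_seq // => s /andP[_ /s0 ->]; rewrite scale0r.
have := vanish t; rewrite (bigD1_seq t) ?support_uniq //= tri // eqxx mulr1.
rewrite big1_seq ?addr0 => [/eqP|s /andP[st su]]; first by rewrite (negPf t_nz).
have [->|s_nz] := eqVneq (coefficient s u) 0; first by rewrite mul0r.
by rewrite tri ?(negPf st) ?mulr0 // tmax.
Qed.

End FreeSpaceTheory.

Lemma lext_span (K : fieldType) (T S : choiceType) (M : freeSpace K T)
    (N : freeSpace K S) (f : T -> N) (P : T -> Prop) (Q : S -> Prop) (u : M) :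
  (forall t, P t -> inspan Q (f t)) -> inspan P u -> inspan Q (lext f u).
Proof.
move=> PQ; elim=> [|a t v Pt _ IH]; first by rewrite lext0; constructor.
by rewrite lextP lext_basis; apply: inspanP => //; exact: PQ.
Qed.

(** * Operations of a Dyck algebra *)

Section DyckTheory.
Variables (K : fieldType) (m : nat) (A : dyckAlg K m).
Implicit Types (i : 'I_m.+1) (x y z : A).

Lemma opPl i a x y z :
  dyck_op i (a *: x + y) z = a *: dyck_op i x z + dyck_op i y z.
Proof. by have [l _] := dyck_bilinear A i; exact: (l z a x y). Qed.

Lemma opPr i a x y z :
  dyck_op i z (a *: x + y) = a *: dyck_op i z x + dyck_op i z y.
Proof. by have [_ r] := dyck_bilinear A i; exact: (r z a x y). Qed.

Lemma op0l i z : dyck_op i 0 z = 0.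
Proof. by have /= := opPl i (-1) 0 0 z; rewrite scaleN1r addNr scaleN1r addNr. Qed.

Lemma op0r i z : dyck_op i z 0 = 0.
Proof. by have /= := opPr i (-1) 0 0 z; rewrite scaleN1r addNr scaleN1r addNr. Qed.

(** The second family of relations, solved for its term that has the operation
   [i] twice on the right. *)
Lemma op_same i x y z :
  dyck_op i x (dyck_op i y z) =
  \sum_(k < m.+1 | (i <= k)%N) dyck_op i (dyck_op k x y) z
  - \sum_(j < m.+1 | (j < i)%N) dyck_op i x (dyck_op j y z).
Proof.
rewrite -dyck_sum (bigD1 i) //= -addrA; symmetry.
rewrite [X in _ + (X - _)](eq_bigl (fun j : 'I_m.+1 => (j < i)%N)) ?subrr ?addr0 //.
by move=> j; rewrite ltn_neqAle andbC.
Qed.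

End DyckTheory.

(** * Trees *)

Inductive tree (m : nat) (X : Type) :=
  Leaf of X | Op of 'I_m.+1 & tree m X & tree m X.

HB.instance Definition _ m X := gen_eqMixin (tree m X).
HB.instance Definition _ m X := gen_choiceMixin (tree m X).

Section Trees.
Variables (m : nat) (X : Type).
Implicit Types t l r : tree m X.

(** Shifted by one so that a leaf ranks below every operation. *)
Definition rank t := if t is Op i _ _ then i.+1 else 0.

(** The irreducible products for the orientation that rewrites
   [x *_i (y *_j z)] when [i <= j]. *)
Fixpoint normal t :=
  if t is Op i l r then [&& normal l, normal r & rank r <= i]%N else true.

Fixpoint leaves t := if t is Op _ l r then (leaves l + leaves r)%N else 1%N.

Fixpoint weight (q : 'I_m.+1) t : nat :=
  if t is Op i l r then
    (weight q l + weight q r + (i == q) * leaves r)%N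
  else 0%N.

Lemma leaves_gt0 t : (0 < leaves t)%N.
Proof. by elim: t => //= i l IHl r _; rewrite addn_gt0 IHl. Qed.

End Trees.

Fixpoint eval (K : fieldType) m X (A : dyckAlg K m) (f : X -> A) (t : tree m X) : A :=
  match t with
  | Leaf x => f x
  | Op i l r => dyck_op i (eval f l) (eval f r)
  end.

(** * The product of trees *)

(** Both hypotheses hold for [G p k = x *_p (y *_k z)] and
   [F p k = (x *_k y) *_p z], where they are the two families of
   relations; the conclusions are what these give for whole ranges of
   operations. *)
Section RangeSums.
Variables (m : nat) (V : zmodType) (F G : 'I_m.+1 -> 'I_m.+1 -> V).
Hypothesis FG : forall p k : 'I_m.+1, (p < k)%N -> G p k = F k p.
Hypothesis sumFG : forall p : 'I_m.+1,
  \sum_(k < m.+1 | (k <= p)%N) G p k = \sum_(k < m.+1 | (p <= k)%N) F p k.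

Lemma sum_upper_range i :
  \sum_(p < m.+1 | (i <= p)%N) \sum_(k < m.+1) G p k
  = \sum_(p < m.+1 | (i <= p)%N) \sum_(k < m.+1 | (i <= k)%N) F p k.
Proof.
under eq_bigr => p _.
  rewrite (bigID (fun k : 'I_m.+1 => (k <= p)%N)) /= sumFG.
  under [X in _ + X]eq_bigr => k pk do rewrite FG ?ltnNge //.
  over.
rewrite big_split /= [X in _ + X](exchange_big_dep (fun k : 'I_m.+1 => (i <= k)%N)) /=;
  last by move=> p k; lia.
rewrite -big_split; apply: eq_bigr => p ip /=.
rewrite [RHS](bigID (fun k : 'I_m.+1 => (p <= k)%N)) /=.
by congr (_ + _); apply: eq_bigl => k; lia.
Qed.

Lemma sum_lower_range (i : nat) :
  \sum_(p < m.+1 | (p < i)%N) \sum_(k < m.+1) F p k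
  = \sum_(p < m.+1 | (p < i)%N) \sum_(k < m.+1 | (k < i)%N) G p k.
Proof.
under [RHS]eq_bigr => p pi.
  rewrite (bigID (fun k : 'I_m.+1 => (k <= p)%N)) /=.
  rewrite [X in X + _](eq_bigl (fun k : 'I_m.+1 => (k <= p)%N)); last by move=> k; lia.
  rewrite sumFG.
  under [X in _ + X]eq_bigr => k /andP[_ pk] do rewrite FG ?ltnNge //.
  over.
rewrite big_split /= [X in _ + X](exchange_big_dep (fun k : 'I_m.+1 => (k < i)%N)) /=;
  last by move=> p k _ /andP[].
rewrite -big_split; apply: eq_bigr => p ip /=.
rewrite [LHS](bigID (fun k : 'I_m.+1 => (p <= k)%N)) /=.
by congr (_ + _); apply: eq_bigl => k; lia.
Qed.

End RangeSums.

(** The verification that the product of trees is a Dyck structure, isolated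
   from trees: [graft] is the bilinear extension of the formal operations, and
   [mul] obeys the two rewriting rules that move an operation out of the right
   factor. *)
Section Relations.
Variables (K : fieldType) (m : nat) (V : lmodType K).
Variables mul graft : 'I_m.+1 -> V -> V -> V.
Hypothesis mul_bil : forall i, bilinear_for *:%R *:%R (mul i).
Hypothesis graft_bil : forall i, bilinear_for *:%R *:%R (graft i).
Hypothesis mul_graft_gt : forall (i j : 'I_m.+1) u v w, (i < j)%N ->
  mul i u (graft j v w) = graft j (mul i u v) w.
Hypothesis mul_graft_eq : forall i u v w, mul i u (graft i v w) =
  \sum_(k < m.+1 | (i <= k)%N) graft i (mul k u v) w
  - \sum_(k < m.+1 | (k < i)%N) graft i u (mul k v w).

Definition assoc_at w := forall (i j : 'I_m.+1) u v, (i < j)%N ->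
  mul i u (mul j v w) = mul j (mul i u v) w.

Definition sum_at w := forall (i : 'I_m.+1) u v,
  \sum_(j < m.+1 | (j <= i)%N) mul i u (mul j v w)
  = \sum_(k < m.+1 | (i <= k)%N) mul i (mul k u v) w.

(** What holds when [w] is a tree of root below [i]: products with it are
   normal already, and multiplying it first by a smaller operation does not
   change this. *)
Definition formal_at (i : 'I_m.+1) w :=
  (forall u, mul i u w = graft i u w) /\
  forall (j : 'I_m.+1) u v, (j < i)%N ->
    mul i u (mul j v w) = graft i u (mul j v w).

Let mul_sumr i p F u :
  mul i u (\sum_(j < m.+1 | p j) F j) = \sum_(j < m.+1 | p j) mul i u (F j).
Proof. exact: (bilinear_sumr (mul_bil i)). Qed.

Let graft_suml i p F u :
  graft i (\sum_(j < m.+1 | p j) F j) u = \sum_(j < m.+1 | p j) graft i (F j) u.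
Proof. exact: (bilinear_suml (graft_bil i)). Qed.

Let graft_sumr i p F u :
  graft i u (\sum_(j < m.+1 | p j) F j) = \sum_(j < m.+1 | p j) graft i u (F j).
Proof. exact: (bilinear_sumr (graft_bil i)). Qed.

Let mulB i u v w : mul i u (v - w) = mul i u v - mul i u w.
Proof.
have [_ r] := mul_bil i.
by have /= := r u (-1) w v; rewrite !scaleN1r => E; rewrite addrC E addrC.
Qed.

Lemma sum_at_formal w i u v : formal_at i w ->
  \sum_(j < m.+1 | (j <= i)%N) mul i u (mul j v w)
  = \sum_(k < m.+1 | (i <= k)%N) mul i (mul k u v) w.
Proof.
move=> [f1 f2]; rewrite (bigD1 i) //= f1 mul_graft_eq.
rewrite -addrA [X in _ + (_ + X)](eq_big (fun j : 'I_m.+1 => (j < i)%N)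
  (fun j => graft i u (mul j v w))) => [|j|j /andP[ji jni]].
- by rewrite addNr addr0; apply: eq_bigr => k ik; rewrite f1.
- by rewrite ltn_neqAle andbC.
- by rewrite f2 // ltn_neqAle jni.
Qed.

Lemma assoc_at_formal w (i j : 'I_m.+1) u v : (i < j)%N -> formal_at j w ->
  mul i u (mul j v w) = mul j (mul i u v) w.
Proof. by move=> ij [f1 _]; rewrite !f1 mul_graft_gt. Qed.

(** For [j = a] the rewriting replaces [j] in the left factor by all operations
   from [j] on, which is why [assoc_at] quantifies over [j]. *)
Lemma assoc_at_graft (a : 'I_m.+1) w1 w2 :
  (forall i : 'I_m.+1, (a < i)%N -> formal_at i (graft a w1 w2)) ->
  assoc_at w1 -> assoc_at (graft a w1 w2).
Proof.
move=> formal IH1 i j u v ij; case: (ltngtP j a) => ja.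
- by rewrite !mul_graft_gt ?(ltn_trans ij) // IH1.
- by apply: assoc_at_formal => //; exact: formal.
have <- : j = a by apply: val_inj.
rewrite !mul_graft_eq mulB !mul_sumr.
congr (_ - _); apply: eq_bigr => p pj; rewrite mul_graft_gt //.
by rewrite IH1 // (leq_trans ij).
Qed.

(** In the case [i = a], both sides expand into grafts that group the four
   factors as [(u v w1) w2], [u (v w1 w2)] or [(u v) (w1 w2)].  The last ones
   are the same on both sides; the first ones agree by the relations at [w1];
   the second ones only occur on the left, and cancel by the relations at
   [w2]. *)
Lemma sum_at_graft (a : 'I_m.+1) w1 w2 :
  (forall i : 'I_m.+1, (a < i)%N -> formal_at i (graft a w1 w2)) ->
  assoc_at w1 -> assoc_at w2 -> sum_at w1 -> sum_at w2 ->
  sum_at (graft a w1 w2).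
Proof.
move=> formal A1 A2 S1 S2 i u v; case: (ltngtP i a) => ia.
- under eq_bigr => j ji do rewrite !mul_graft_gt ?(leq_ltn_trans ji) //.
  under [RHS]eq_bigr => j ji do rewrite mul_graft_gt //.
  by rewrite -!graft_suml S1.
- by apply: sum_at_formal; exact: formal.
have <- : i = a by apply: val_inj.
have expand (k : 'I_m.+1) : mul i u (graft i (mul k v w1) w2) =
    graft i (\sum_(p < m.+1 | (i <= p)%N) mul p u (mul k v w1)) w2
    - graft i u (\sum_(p < m.+1 | (p < i)%N) mul p (mul k v w1) w2).
  by rewrite mul_graft_eq graft_suml graft_sumr.
transitivity (\sum_(k < m.+1) mul i u (graft i (mul k v w1) w2)
    - \sum_(k < m.+1 | (k < i)%N) mul i u (graft i v (mul k w1 w2))).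
  rewrite (bigD1 i) //= mul_graft_eq mulB !mul_sumr.
  rewrite [in RHS](bigID (fun k : 'I_m.+1 => (i <= k)%N)) /= -!addrA; congr (_ + _).
  rewrite addrC; congr (_ + _); apply: eq_big => k.
    by rewrite -ltnNge ltn_neqAle andbC.
  by case/andP=> ki kni; rewrite mul_graft_gt // ltn_neqAle kni.
rewrite (eq_bigr _ (fun k _ => expand k)) sumrB -!graft_suml -!graft_sumr.
rewrite exchange_big [X in _ - graft _ _ X - _]exchange_big /=.
rewrite (@sum_upper_range _ _ (fun p k => mul p (mul k u v) w1)); last 2 first.
- by move=> p k; exact: A1.
- by move=> p; exact: S1.
rewrite (@sum_lower_range _ _ _ (fun p k => mul p v (mul k w1 w2))); last 2 first.
- by move=> p k; exact: A2.
- by move=> p; exact: S2.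
under [X in _ - X = _]eq_bigr => k _ do rewrite mul_graft_eq.
under [RHS]eq_bigr => k _ do rewrite mul_graft_eq.
rewrite !sumrB.
have -> : graft i (\sum_(p < m.+1 | (i <= p)%N)
      \sum_(k < m.+1 | (i <= k)%N) mul p (mul k u v) w1) w2
    = \sum_(k < m.+1 | (i <= k)%N)
      \sum_(p < m.+1 | (i <= p)%N) graft i (mul p (mul k u v) w1) w2.
  by rewrite exchange_big graft_suml; apply: eq_bigr => k _; rewrite graft_suml.
have -> : graft i u (\sum_(p < m.+1 | (p < i)%N)
      \sum_(k < m.+1 | (k < i)%N) mul p v (mul k w1 w2))
    = \sum_(k < m.+1 | (k < i)%N)
      \sum_(p < m.+1 | (p < i)%N) graft i u (mul p v (mul k w1 w2)).
  by rewrite exchange_big graft_sumr; apply: eq_bigr => k _; rewrite graft_sumr.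
by rewrite opprB addrA subrK; congr (_ - _); exact: exchange_big.
Qed.

End Relations.

Section Model.
Variables (K : fieldType) (m : nat) (X : Type).
Local Notation tree := (tree m X).
Local Notation M := (free_space K tree).
Local Notation b := (basis M).
Implicit Types (i j k : 'I_m.+1) (l r t : tree) (u v w : M).

Definition graftM i u v : M :=
  lext (fun l => lext (fun r => b (Op i l r)) v) u.

(** The product of two trees, read off from the relations oriented so that
   an operation in the right factor moves out to the root, or is traded for
   a smaller one. *)
Fixpoint tree_mul r i l : M :=
  match r with
  | Leaf _ => b (Op i l r)
  | Op j r1 r2 =>
    if (j < i)%N then b (Op i l r)
    else if (i < j)%N then lext (fun s => b (Op j s r2)) (tree_mul r1 i l)
    else \sum_(k < m.+1 | (i <= k)%N)
           lext (fun s => b (Op i s r2)) (tree_mul r1 k l)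
         - \sum_(k < m.+1 | (k < i)%N)
           lext (fun s => b (Op i l s)) (tree_mul r2 k r1)
  end.

Definition mulM i u v : M :=
  lext (fun r => lext (tree_mul r i) u) v.

Lemma lext_pointwise (V : lmodType K) (f g h : tree -> V) a u :
  (forall t, f t = a *: g t + h t) -> lext f u = a *: lext g u + lext h u.
Proof.
move=> fE; move: u; apply: basis_ind => [|c u v IHu IHv|t].
- by rewrite !lext0 scaler0 addr0.
- by rewrite !lextP IHu IHv !scalerDr !scalerA mulrC addrACA.
- by rewrite !lext_basis.
Qed.

Lemma graftPl i a u v w : graftM i (a *: u + v) w = a *: graftM i u w + graftM i v w.
Proof. by rewrite /graftM lextP. Qed.

Lemma graftPr i a u v w : graftM i w (a *: u + v) = a *: graftM i w u + graftM i w v.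
Proof. by apply: lext_pointwise => l; rewrite lextP. Qed.

Lemma graft_basis i l r : graftM i (b l) (b r) = b (Op i l r).
Proof. by rewrite /graftM !lext_basis. Qed.

Lemma graft_basisl i l v : graftM i (b l) v = lext (fun r => b (Op i l r)) v.
Proof. by rewrite /graftM lext_basis. Qed.

Lemma graft_basisr i r u : graftM i u (b r) = lext (fun l => b (Op i l r)) u.
Proof.
by rewrite /graftM; congr lext; apply: funext => l; rewrite lext_basis.
Qed.

Lemma mulPr i a u v w : mulM i w (a *: u + v) = a *: mulM i w u + mulM i w v.
Proof. by rewrite /mulM lextP. Qed.

Lemma mulPl i a u v w : mulM i (a *: u + v) w = a *: mulM i u w + mulM i v w.
Proof. by apply: lext_pointwise => r; rewrite lextP. Qed.

Lemma mul_basis i l r : mulM i (b l) (b r) = tree_mul r i l.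
Proof. by rewrite /mulM !lext_basis. Qed.

Lemma mul0r i u : mulM i u 0 = 0. Proof. by rewrite /mulM lext0. Qed.

Lemma mul0l i u : mulM i 0 u = 0.
Proof.
by have := mulPl i (-1) 0 0 u; rewrite scaleN1r addNr scaleN1r addNr.
Qed.

Lemma graft0r i u : graftM i u 0 = 0.
Proof.
by have := graftPr i (-1) 0 0 u; rewrite scaleN1r addNr scaleN1r addNr.
Qed.

Lemma graft0l i u : graftM i 0 u = 0. Proof. by rewrite /graftM lext0. Qed.

Lemma mulM_bilinear i : bilinear_for *:%R *:%R (mulM i).
Proof. by split=> w a u v /=; [exact: mulPl|exact: mulPr]. Qed.

Lemma graftM_bilinear i : bilinear_for *:%R *:%R (graftM i).
Proof. by split=> w a u v /=; [exact: graftPl|exact: graftPr]. Qed.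

Lemma mul_lt i u v : inspan (fun t => rank t <= i)%N v -> mulM i u v = graftM i u v.
Proof.
elim=> [|a r v1 ri _ h1]; first by rewrite mul0r graft0r.
rewrite mulPr graftPr h1; congr (_ *: _ + _).
rewrite graft_basisr /mulM lext_basis; congr lext; apply: funext => l.
by case: r ri => //= j r1 r2 ->.
Qed.

Lemma mul_span i (P Q R : tree -> Prop) u v :
  (forall l r, P l -> Q r -> inspan R (tree_mul r i l)) ->
  inspan P u -> inspan Q v -> inspan R (mulM i u v).
Proof.
move=> PQR Pu Qv; apply: lext_span Qv => r Qr.
by apply: lext_span Pu => l Pl; apply: PQR.
Qed.

Lemma graft_span i (P Q R : tree -> Prop) u v :
  (forall l r, P l -> Q r -> R (Op i l r)) ->
  inspan P u -> inspan Q v -> inspan R (graftM i u v).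
Proof.
move=> PQR Pu Qv; apply: lext_span Pu => l Pl.
by apply: lext_span Qv => r Qr; apply: inspan_basis; exact: PQR.
Qed.

Lemma rank_basis i t : (rank t <= i)%N -> inspan (fun t => rank t <= i)%N (b t).
Proof. by move=> ti; apply: inspan_basis. Qed.

Lemma mul_graft_gt i j u v w : (i < j)%N ->
  mulM i u (graftM j v w) = graftM j (mulM i u v) w.
Proof.
move=> ij; move: w v u; apply: basis_ind => [|a v1 v2 h1 h2|r2] v u.
- by rewrite !graft0r mul0r.
- by rewrite !graftPr mulPr h1 h2.
move: v u; apply: basis_ind => [|a v1 v2 h1 h2|r1] u.
- by rewrite graft0l !mul0r graft0l.
- by rewrite graftPl !mulPr graftPl h1 h2.
move: u; apply: basis_ind => [|a v1 v2 h1 h2|l].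
- by rewrite !mul0l graft0l.
- by rewrite !mulPl graftPl h1 h2.
by rewrite graft_basis !mul_basis /= ij ltnNge (ltnW ij) /= graft_basisr.
Qed.

Lemma mul_graft_eq i u v w : mulM i u (graftM i v w) =
  \sum_(k < m.+1 | (i <= k)%N) graftM i (mulM k u v) w
  - \sum_(k < m.+1 | (k < i)%N) graftM i u (mulM k v w).
Proof.
have D (p : pred 'I_m.+1) a (F G : 'I_m.+1 -> M) :
    a *: (\sum_(k | p k) F k) + \sum_(k | p k) G k = \sum_(k | p k) (a *: F k + G k).
  by rewrite scaler_sumr big_split.
have Q (p q : pred 'I_m.+1) a (F G F' G' : 'I_m.+1 -> M) :
    a *: (\sum_(k | p k) F k - \sum_(k | q k) F' k)
      + (\sum_(k | p k) G k - \sum_(k | q k) G' k)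
    = \sum_(k | p k) (a *: F k + G k) - \sum_(k | q k) (a *: F' k + G' k).
  by rewrite -!D scalerBr opprD addrACA.
move: w v u; apply: basis_ind => [|a v1 v2 h1 h2|r2] v u.
- rewrite !graft0r mul0r !big1 ?subrr // => k _; first by rewrite mul0r graft0r.
  by rewrite graft0r.
- rewrite !graftPr mulPr h1 h2 Q; congr (_ - _); apply: eq_bigr => k _.
    by rewrite graftPr.
  by rewrite mulPr graftPr.
move: v u; apply: basis_ind => [|a v1 v2 h1 h2|r1] u.
- rewrite graft0l mul0r !big1 ?subrr // => k _; first by rewrite mul0l graft0r.
  by rewrite mul0r graft0l.
- rewrite graftPl mulPr h1 h2 Q; congr (_ - _); apply: eq_bigr => k _.
    by rewrite mulPr graftPl.
  by rewrite mulPl graftPr.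
move: u; apply: basis_ind => [|a v1 v2 h1 h2|l].
- rewrite mul0l !big1 ?subrr // => k _; first by rewrite graft0l.
  by rewrite mul0l graft0l.
- rewrite mulPl h1 h2 Q; congr (_ - _); apply: eq_bigr => k _.
    by rewrite mulPl graftPl.
  by rewrite graftPl.
rewrite graft_basis mul_basis /= ltnn; congr (_ - _); apply: eq_bigr => k _.
  by rewrite mul_basis graft_basisr.
by rewrite mul_basis graft_basisl.
Qed.

(** The bound on the weight is that of the formal product by [q], whatever the
   operation [i]: rewriting changes the operations, so that only a bound that
   does not depend on [i] can be proved by induction. *)
Lemma tree_mul_span q r i l :
  inspan (fun t => [/\ leaves t = leaves l + leaves r,
                       rank t = maxn i.+1 (rank r),
                       weight q t <= weight q l + weight q r + leaves r
                     & normal l -> normal r -> normal t])%N (tree_mul r i l).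
Proof.
elim: r i l => [x|j r1 IH1 r2 IH2] i l /=.
  apply: inspan_basis; rewrite /= maxn0 addn0 muln1; split=> //.
    by case: (i == q); lia.
  by move=> ->.
have lr2 := leaves_gt0 r2.
case: (ltngtP j i) => ji.
- apply: inspan_basis; split=> //=; [lia| |by move=> -> /and3P[-> -> ->]].
  by case: (i == q); lia.
- apply: lext_span (IH1 i l) => s [ls rs ws ns].
  apply: inspan_basis => /=; split; [lia|lia|lia|].
  by move=> nl /and3P[n1 -> ->]; rewrite ns.
have -> : i = j by apply: val_inj.
apply: inspanB; apply: inspan_sum => k kj.
  apply: lext_span (IH1 k l) => s [ls rs ws ns].
  apply: inspan_basis => /=; split; [lia|lia|lia|].
  by move=> nl /and3P[n1 -> ->]; rewrite ns.
apply: lext_span (IH2 k r1) => s [ls rs ws ns].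
apply: inspan_basis => /=; split; [lia|lia|case: (j == q) => /=; lia|].
by move=> nl /and3P[n1 n2 r2j]; rewrite nl ns // rs geq_max kj.
Qed.

Lemma mul_rank i j u v : (j < i)%N ->
  inspan (fun t => rank t <= i)%N v -> inspan (fun t => rank t <= i)%N (mulM j u v).
Proof.
move=> ji; apply: mul_span (inspanT u) => l r _ ri.
by apply: (inspan_sub _ (tree_mul_span j r j l)) => t [_ -> _ _]; rewrite geq_max ji.
Qed.

Lemma formal_rank i t : (rank t <= i)%N -> formal_at mulM graftM i (b t).
Proof.
move=> ti; split=> [u|j u v ji]; rewrite mul_lt //; first exact: rank_basis.
by apply: mul_rank => //; exact: rank_basis.
Qed.

Lemma relations_basis t : assoc_at mulM (b t) /\ sum_at mulM (b t).
Proof.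
elim: t => [x|a t1 [A1 S1] t2 [A2 S2]].
  split=> [i j u v ij|i u v].
    apply: (assoc_at_formal (graft := graftM)) => //; first exact: mul_graft_gt.
    exact: formal_rank.
  by apply: (sum_at_formal (graft := graftM)); [exact: mul_graft_eq|exact: formal_rank].
rewrite -graft_basis.
have F (i : 'I_m.+1) : (a < i)%N -> formal_at mulM graftM i (graftM a (b t1) (b t2)).
  by move=> ai; rewrite graft_basis; apply: formal_rank.
split.
  by apply: assoc_at_graft => //; [exact: mulM_bilinear|exact: mul_graft_gt
    |exact: mul_graft_eq].
by apply: sum_at_graft => //; [exact: mulM_bilinear|exact: graftM_bilinear
  |exact: mul_graft_gt|exact: mul_graft_eq].
Qed.

Lemma mul_assoc i j u v w : (i < j)%N ->
  mulM i u (mulM j v w) = mulM j (mulM i u v) w.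
Proof.
move=> ij; move: w; apply: basis_ind => [|a w1 w2 h1 h2|t].
- by rewrite !mul0r.
- by rewrite !mulPr h1 h2.
- by have [A _] := relations_basis t; exact: A.
Qed.

Lemma mul_sum i u v w :
  \sum_(j < m.+1 | (j <= i)%N) mulM i u (mulM j v w)
  = \sum_(k < m.+1 | (i <= k)%N) mulM i (mulM k u v) w.
Proof.
move: w; apply: basis_ind => [|a w1 w2 h1 h2|t].
- by rewrite !big1 // => k _; rewrite !mul0r.
- under eq_bigr => j _ do rewrite !mulPr.
  under [RHS]eq_bigr => j _ do rewrite mulPr.
  by rewrite !big_split -!scaler_sumr /= h1 h2.
- by have [_ S] := relations_basis t; exact: S.
Qed.

Definition tree_alg : dyckAlg K m := DyckAlg mulM_bilinear mul_assoc mul_sum.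

(** In the tree algebra a normal tree is the value of the product it spells,
   so the products of generators spelled by distinct normal trees are linearly
   independent in any algebra mapping to it. *)
Lemma eval_normal t : normal t ->
  eval (A := tree_alg) (fun x => b (Leaf m x)) t = b t.
Proof.
elim: t => //= i l IHl r IHr /and3P[nl nr ri].
by rewrite IHl // IHr // [LHS]mul_lt ?graft_basis //; exact: rank_basis.
Qed.

Section Evaluation.
Variables (A : dyckAlg K m) (f : X -> A).

Definition evalM : M -> A := lext (eval f).

Lemma evalM_basis t : evalM (b t) = eval f t.
Proof. exact: lext_basis. Qed.

Lemma evalMP a u v : evalM (a *: u + v) = a *: evalM u + evalM v.
Proof. exact: lextP. Qed.

HB.instance Definition _ := GRing.isLinear.Build K M A *:%R evalM evalMP.

Lemma evalM_graft i u v : evalM (graftM i u v) = dyck_op i (evalM u) (evalM v).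
Proof.
move: u; apply: basis_ind => [|a u1 u2 h1 h2|l].
- by rewrite graft0l raddf0 op0l.
- by rewrite graftPl !evalMP h1 h2 opPl.
move: v; apply: basis_ind => [|a v1 v2 h1 h2|r].
- by rewrite graft0r raddf0 op0r.
- by rewrite graftPr !evalMP h1 h2 opPr.
- by rewrite graft_basis !evalM_basis.
Qed.

(** Each rewriting step used by the product is a consequence of the relations,
   so evaluation respects products even of trees that are not normal. *)
Lemma evalM_mul i u v : evalM (mulM i u v) = dyck_op i (evalM u) (evalM v).
Proof.
move: v; apply: basis_ind => [|a v1 v2 h1 h2|r].
- by rewrite mul0r raddf0 op0r.
- by rewrite mulPr !evalMP h1 h2 opPr.
elim: r i u => [x|j r1 IH1 r2 IH2] i u.
  by rewrite mul_lt ?evalM_graft //; exact: rank_basis.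
case: (ltngtP i j) => ij.
- by rewrite -graft_basis mul_graft_gt // !evalM_graft IH1 dyck_assoc.
- by rewrite mul_lt ?evalM_graft //; exact: rank_basis.
have <- : i = j by apply: val_inj.
rewrite -graft_basis mul_graft_eq evalM_graft op_same raddfB.
congr (_ - _); rewrite raddf_sum; apply: eq_bigr => k _ /=.
  by rewrite evalM_graft IH1.
by rewrite evalM_graft IH2.
Qed.

Lemma eval_tree_mul i l r :
  dyck_op i (eval f l) (eval f r) = evalM (tree_mul r i l).
Proof. by rewrite -mul_basis evalM_mul !evalM_basis. Qed.

End Evaluation.

End Model.

(** * Normal trees and freeness *)

Lemma mul_normal (K : fieldType) m X i (u v : free_space K (tree m X)) :
  inspan (@normal m X) u -> inspan (@normal m X) v -> inspan (@normal m X) (mulM i u v).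
Proof.
apply: mul_span => l r nl nr.
by apply: (inspan_sub _ (tree_mul_span K i r i l)) => t [_ _ _ nt]; exact: nt.
Qed.

Lemma eval_in_normal_span (K : fieldType) m X (A : dyckAlg K m) (f : X -> A) t :
  exists2 u : free_space K (tree m X), inspan (@normal m X) u & eval f t = evalM f u.
Proof.
elim: t => [x|i l [u nu lu] r [v nv rv]].
  by exists (basis _ (Leaf m x)); [exact: inspan_basis|rewrite evalM_basis].
by exists (mulM i u v); [exact: mul_normal|rewrite evalM_mul /= lu rv].
Qed.

Lemma evalM_in_normal_span (K : fieldType) m X (A : dyckAlg K m) (f : X -> A)
    (u : free_space K (tree m X)) :
  exists2 v : free_space K (tree m X), inspan (@normal m X) v & evalM f u = evalM f v.
Proof.
move: u; apply: basis_ind => [|a u u' [v nv Ev] [v' nv' Ev']|t].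
- by exists 0 => //; constructor.
- by exists (a *: v + v'); [exact: inspanP|rewrite !evalMP Ev Ev'].
- by rewrite evalM_basis; exact: eval_in_normal_span.
Qed.

(** The hom extending [f] evaluates normal forms; it is multiplicative because
   products of normal trees are reduced to normal trees by the same steps in
   every algebra. *)
Lemma free_of_normal_basis (K : fieldType) m Y (B : dyckAlg K m) (g : Y -> B) :
  (forall d, exists u, evalM g u = d) ->
  (forall u, inspan (@normal m Y) u -> evalM g u = 0 -> u = 0) ->
  dyck_free_over g.
Proof.
move=> gen indep A f.
have nf d : {u | inspan (@normal m Y) u /\ evalM g u = d}.
  apply: cid; have [u <-] := gen d; have [v nv ->] := evalM_in_normal_span g u.
  by exists v.
pose phi d := evalM f (sval (nf d)).
have phiE u : inspan (@normal m Y) u -> phi (evalM g u) = evalM f u.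
  rewrite /phi; case: (nf _) => v [nv /= Ev] nu; congr evalM.
  apply: subr0_eq; apply: indep; first exact: inspanB.
  by rewrite raddfB /= Ev subrr.
exists phi; split.
- have nfE d : exists2 u, inspan (@normal m Y) u & evalM g u = d.
    by have [u [nu Eu]] := nf d; exists u.
  split=> [a d e|i d e]; have [u nu <-] := nfE d; have [v nv <-] := nfE e.
    by rewrite -evalMP !phiE ?evalMP //; exact: inspanP.
  by rewrite -evalM_mul !phiE // ?evalM_mul //; exact: mul_normal.
- move=> y; rewrite -[g y](evalM_basis g (Leaf m y)) phiE ?evalM_basis //.
  exact: inspan_basis.
move=> psi [psiP psiM] psig d; have [v [nv <-]] := nf d.
rewrite phiE //; clear nv; move: v.
apply: basis_ind => [|a v v' h h'|t].
- rewrite !raddf0; have /= := psiP (-1) 0 0.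
  by rewrite scaleN1r addNr scaleN1r addNr.
- by rewrite !evalMP psiP h h'.
rewrite !evalM_basis; elim: t => [y|i l IHl r IHr] /=; first exact: psig.
by rewrite psiM IHl IHr.
Qed.

(** * Generators of the merged algebra *)

Section Generators.
Variables (m : nat) (X : Type) (k : 'I_m.+1).
Local Notation xtree := (tree m.+1 X).
Local Notation lo := (widen_ord (leqnSn m.+1)).
Local Notation hi := (lift (ord0 : 'I_m.+2)).

(** Operations from [k] on commute with left multiplications by smaller ones.
   So the first subtree of the left branch whose root is not such an operation,
   called the core, tells whether a left factor can be pulled out: it can unless
   the core is a leaf, which gives rank 0. *)
Fixpoint core_rank (t : xtree) : nat :=
  if t is Op j l _ then (if (k <= j)%N then core_rank l else j.+1) else 0.

(** Excluded are the products that the relations express by others: those with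
   a left factor to pull out of [l], and those with [r] of root [k] or more. *)
Definition generator (t : xtree) : bool :=
  if t is Op j l r then
    [&& j == lo k, core_rank l == 0%N, normal l, normal r & (rank r <= k)%N]
  else true.

Definition gen_tree := {t : xtree | generator t}.

Definition to_gen t (gt : generator t) : gen_tree := exist _ t gt.

Lemma generator_normal t : generator t -> normal t.
Proof. by case: t => //= j l r /and5P[/eqP -> _ -> -> /= rk]. Qed.

(** The left factor found at the core passes through the operations of the
   branch. *)
Lemma split_core (K : fieldType) (A : dyckAlg K m.+1) (f : X -> A) (t : xtree) :
  normal t -> core_rank t != 0%N -> exists (i : 'I_m.+2) (l r : xtree),
    [/\ (i < k)%N, normal l, normal r, leaves t = (leaves l + leaves r)%N
      & eval f t = dyck_op i (eval f l) (eval f r)].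
Proof.
elim: t => //= j l IHl r _ /and3P[nl nr rj].
case: leqP => [kj cl|jk _]; last by exists j, l, r.
have [i [l1 [l2 [ik n1 n2 ll El]]]] := IHl nl cl.
exists i, l1, (Op j l2 r); split=> //=; first by rewrite n2 nr.
  by rewrite ll addnA.
by rewrite El dyck_assoc // (leq_trans ik).
Qed.

Section Generation.
Variables (K : fieldType) (D : dyckAlg K m.+1) (iota : X -> D).
Local Notation B := (dyckS D k).

Definition gen_val (y : gen_tree) : B := eval iota (val y).

Definition reached (d : D) :=
  exists u : free_space K (tree m gen_tree), evalM gen_val u = d.

Lemma reached0 : reached 0.
Proof. by exists 0; rewrite raddf0. Qed.

Lemma reachedP a d e : reached d -> reached e -> reached (a *: d + e).
Proof. by move=> [u <-] [v <-]; exists (a *: u + v); rewrite evalMP. Qed.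

Lemma reachedB d e : reached d -> reached e -> reached (d - e).
Proof. by move=> rd re; rewrite addrC -scaleN1r; exact: reachedP. Qed.

Lemma reached_sum (I : finType) (p : pred I) (F : I -> D) :
  (forall i, p i -> reached (F i)) -> reached (\sum_(i | p i) F i).
Proof.
move=> pF; elim/big_rec: _ => [|i d pi rd]; first exact: reached0.
by rewrite -[F i]scale1r; apply: reachedP => //; exact: pF.
Qed.

Lemma reached_op (j : 'I_m.+1) d e :
  reached d -> reached e -> reached (dyckS_op k j d e).
Proof. by move=> [u <-] [v <-]; exists (mulM j u v); rewrite evalM_mul. Qed.

Lemma reached_lo (i : 'I_m.+2) d e : (i < k)%N ->
  reached d -> reached e -> reached (dyck_op i d e).
Proof.
move=> ik rd re; have im : (i < m.+1)%N by rewrite (ltn_trans ik).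
have := reached_op (Ordinal im) rd re; rewrite /dyckS_op /= ik.
by congr reached; congr dyck_op; apply: val_inj.
Qed.

Lemma reached_hi (j : 'I_m.+1) d e : (k < j)%N ->
  reached d -> reached e -> reached (dyck_op (hi j) d e).
Proof.
move=> kj rd re; have := reached_op j rd re.
by rewrite /dyckS_op ltnNge (ltnW kj) -val_eqE /= gtn_eqF.
Qed.

Lemma reached_merged d e : reached d -> reached e ->
  reached (dyck_op (lo k) d e) -> reached (dyck_op (hi k) d e).
Proof.
move=> rd re rp; have := reachedB (reached_op k rd re) rp.
by rewrite /dyckS_op ltnn eqxx addrC addKr.
Qed.

Lemma reached_span (P : xtree -> Prop) (C : D -> D) u :
  C 0 = 0 -> (forall a x y, C (a *: x + y) = a *: C x + C y) ->
  (forall t, P t -> reached (C (eval iota t))) ->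
  inspan P u -> reached (C (evalM (K := K) iota u)).
Proof.
move=> C0 CD CP; elim=> [|a t v Pt _ IH]; first by rewrite raddf0 C0; exact: reached0.
by rewrite evalMP CD evalM_basis; apply: reachedP => //; exact: CP.
Qed.

(** The heart of the matter is a product [l *_k r] with [r] of root below [k]:
   the left factors of [l] come out, until a generator is left.  A product
   [l *_k r] with [r] of root [k] reduces to this shape by the relations, and
   one by the operation [k.+1] is a merged product minus such a product. *)
Lemma normal_reached n t : normal t -> (leaves t <= n)%N -> reached (eval iota t).
Proof.
elim: n t => [t _|n IH]; first by rewrite leqNgt leaves_gt0.
have low l r : normal l -> normal r -> (rank r <= k)%N ->
    (leaves l + leaves r <= n.+1)%N -> reached (dyck_op (lo k) (eval iota l) (eval iota r)).
  move=> nl nr rk sz; have r0 := leaves_gt0 r.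
  have [c0|c0] := eqVneq (core_rank l) 0%N.
    have gP : generator (Op (lo k) l r) by rewrite /= eqxx c0 nl nr.
    by exists (basis _ (Leaf m (to_gen gP))); rewrite evalM_basis.
  have [i [l1 [l2 [ik n1 n2 ll ->]]]] := split_core iota nl c0.
  have l10 := leaves_gt0 l1; have l20 := leaves_gt0 l2.
  rewrite -dyck_assoc //; apply: reached_lo => //; first by apply: IH => //; lia.
  by apply: (IH (Op (lo k) l2 r)); rewrite /= ?n2 ?nr //; lia.
have mid l r : normal l -> normal r -> (rank r <= k.+1)%N ->
    (leaves l + leaves r <= n.+1)%N -> reached (dyck_op (lo k) (eval iota l) (eval iota r)).
  move=> nl nr; rewrite leq_eqVlt => /orP[rk|rk] sz; last exact: low.
  case: r nr rk sz => [|j r1 r2] //= /and3P[n1 n2 rj]; rewrite eqSS => /eqP jk sz.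
  have -> : j = lo k by apply: val_inj.
  rewrite jk in rj; rewrite op_same; apply: reachedB; apply: reached_sum => i ik.
    rewrite eval_tree_mul.
    apply: (reached_span (C := fun d => dyck_op (lo k) d (eval iota r2))
      _ _ _ (@tree_mul_span K _ _ i r1 i l)) => [|a x y|t [lt _ _ nt]].
    - exact: op0l.
    - exact: opPl.
    - by apply: low; [exact: nt| | |lia].
  rewrite eval_tree_mul.
  apply: (reached_span (C := fun d => dyck_op (lo k) (eval iota l) d)
      _ _ _ (@tree_mul_span K _ _ i r2 i r1)) => [|a x y|t [lt rt _ nt]].
  - exact: op0r.
  - exact: opPr.
  - by apply: low => //; [exact: nt|rewrite rt geq_max rj andbT|lia].
case=> [x _ _|j l r].
  by exists (basis _ (Leaf m (@to_gen (Leaf _ x) isT))); rewrite evalM_basis.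
move=> /= /and3P[nl nr rj] sz; have l0 := leaves_gt0 l; have r0 := leaves_gt0 r.
have rl : reached (eval iota l) by apply: IH => //; lia.
have rr : reached (eval iota r) by apply: IH => //; lia.
case: (ltngtP j k) => jk; first exact: reached_lo.
  case: (unliftP ord0 j) jk rj => [i ->|-> //]; rewrite ltnS leq_eqVlt.
  case/orP=> [/eqP ki ri|ki _]; last exact: reached_hi.
  have <- : k = i by apply: val_inj.
  by apply: reached_merged => //; apply: mid => //; rewrite ki.
have -> : j = lo k by apply: val_inj.
by apply: low => //; rewrite -jk.
Qed.

End Generation.
End Generators.

(** * Leading trees *)

Section Leading.
Variables (m : nat) (X : Type) (k : 'I_m.+1).
Local Notation xtree := (tree m.+1 X).
Local Notation lo := (widen_ord (leqnSn m.+1)).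
Local Notation hi := (lift (ord0 : 'I_m.+2)).
Local Notation stree := (tree m (gen_tree X k)).
Local Notation wt := (@weight m.+1 X (hi k)).

(** Multiplication on the left by [d] with an operation [i] below [k]: it slides
   under the operations from [k] on until it meets the core. *)
Fixpoint attach (i : 'I_m.+2) (d t : xtree) : xtree :=
  match t with
  | Op j l r => if (k <= j)%N then Op j (attach i d l) r else Op i d t
  | Leaf _ => Op i d t
  end.

(** Unlike [attach], passes no operation larger than [k], and [k] only at the
   root: the root of the result is then at most [k], which tells it from the
   trees produced by the other operations. *)
Definition attach_left (i : 'I_m.+2) (d t : xtree) : xtree :=
  match t with
  | Op j l r => if j == lo k then Op j (attach i d l) r else Op i d t
  | Leaf _ => Op i d t
  end.

(** The merged operation becomes [k.+1], and a left factor of a generator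
   [g *_k r] goes into [g], which restores the products by [*_k] that are not
   generators. *)
Fixpoint lead (t : stree) : xtree :=
  match t with
  | Leaf y => val y
  | Op j l r => if (j < k)%N then attach_left (lo j) (lead l) (lead r)
                else Op (hi j) (lead l) (lead r)
  end.

Lemma core_attach (i : 'I_m.+2) d t : (i < k)%N -> core_rank k (attach i d t) = i.+1.
Proof.
move=> ik; elim: t => [x|j l IHl r _] /=; first by rewrite leqNgt ik.
by case: leqP => kj /=; rewrite ?kj ?IHl // leqNgt ik.
Qed.

Lemma attach_inj (i i' : 'I_m.+2) d d' t t' : (i < k)%N -> (i' < k)%N ->
  attach i d t = attach i' d' t' -> [/\ i = i', d = d' & t = t'].
Proof.
move=> ik ik'; elim: t t' => [x|j l IHl r _] [x'|j' l' r'] /=.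
- by case=> -> -> ->.
- by case: leqP => kj' [] // ij; move: kj' ik; rewrite -ij => /leq_ltn_trans h /h; rewrite ltnn.
- by case: leqP => kj [] // ij; move: kj ik'; rewrite ij => /leq_ltn_trans h /h; rewrite ltnn.
case: leqP => kj; case: leqP => kj' [].
- by move=> -> /IHl[-> -> ->] ->.
- by move=> ji; move: kj; rewrite ji leqNgt ik'.
- by move=> ij; move: kj'; rewrite -ij leqNgt ik.
- by move=> -> -> -> -> ->.
Qed.

Lemma attach_left_inj (i i' : 'I_m.+2) d d' t t' : (i < k)%N -> (i' < k)%N ->
  attach_left i d t = attach_left i' d' t' -> [/\ i = i', d = d' & t = t'].
Proof.
move=> ik ik'.
have E (j : 'I_m.+2) : (j < k)%N -> j = lo k -> False by move=> jk e; move: jk; rewrite e ltnn.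
case: t t' => [x|j l r] [x'|j' l' r'] /=.
- by case=> -> -> ->.
- by case: eqP => [->|_] [] // /(E _ ik).
- by case: eqP => [->|_] [] // /esym/(E _ ik').
case: eqP => [->|_]; case: eqP => [->|_] [].
- by move=> /(attach_inj ik ik')[-> -> ->] ->.
- by move/esym/(E _ ik').
- by move/(E _ ik).
- by move=> -> -> -> -> ->.
Qed.

Lemma rank_attach_left (i : 'I_m.+2) d t : (i < k)%N ->
  (0 < rank (attach_left i d t) <= k.+1)%N.
Proof.
move=> ik; case: t => [x|j l r] /=; first by rewrite ltnS ltnW.
by case: eqP => [->|_] /=; rewrite ?ltnS ?leqnn // ltnW.
Qed.

Lemma generator_attach_left (i : 'I_m.+2) d t : (i < k)%N ->
  ~~ generator k (attach_left i d t).
Proof.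
move=> ik; have E : (i == lo k) = false by rewrite -val_eqE /= ltn_eqF.
case: t => [x|j l r] /=; first by rewrite E.
by case: eqP => [->|_] /=; rewrite ?E // core_attach //= andbF.
Qed.

(** The root of [lead t] is [k.+1] or more when that of [t] is the merged or a
   larger operation, and at most [k] otherwise; then [t] is a generator exactly
   when [lead t] has the shape of one, and the last factor attached can be read
   off at the core. *)
Lemma lead_inj : injective lead.
Proof.
have genhi (y : gen_tree X k) (j : 'I_m.+1) l r : val y <> Op (hi j) l r \/ (j < k)%N.
  case: (ltnP j k) => jk; [by right|left=> E].
  have := valP y; rewrite E /= => /andP[/eqP/(congr1 val) /=].
  by rewrite /bump /= add1n => jE; move: jk; rewrite -jE ltnn.
have gen_attach (y : gen_tree X k) (i : 'I_m.+2) d t : (i < k)%N -> val y <> attach_left i d t.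
  by move=> ik E; have := generator_attach_left d t ik; rewrite -E (valP y).
have attach_hi (i : 'I_m.+2) d t (j : 'I_m.+1) l r : (i < k)%N -> (k <= j)%N ->
    attach_left i d t <> Op (hi j) l r.
  move=> ik kj E; have /andP[_] := rank_attach_left d t ik.
  by rewrite E /= /bump /= add1n !ltnS leqNgt ltnS kj.
elim=> [y|j l IHl r IHr] [y'|j' l' r'] /=.
- by move/val_inj ->.
- case: ltnP => jk; first by move/gen_attach=> /(_ jk).
  by case: (genhi y j' (lead l') (lead r')) => //; lia.
- case: ltnP => jk /esym; first by move/gen_attach=> /(_ jk).
  by case: (genhi y' j (lead l) (lead r)) => //; lia.
case: ltnP => jk; case: ltnP => jk'.
- move=> /(@attach_left_inj (lo j) (lo j') _ _ _ _ jk jk')[e /IHl -> /IHr ->].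
  by congr Op; apply: val_inj; exact: (congr1 val e).
- by move/attach_hi=> /(_ jk jk').
- by move/esym/attach_hi=> /(_ jk' jk).
- case=> e /IHl -> /IHr ->; congr Op; apply: val_inj; exact: e.
Qed.

(** The trees that occur in the value of a normal tree whose root has rank
   [c].  The ranks above [k] shift by one between the merged and the original
   operations.  For [c <= k], the second alternative is meant for a generator
   [g *_k r] with left factors attached to [g]; the bound on the core ensures that the
   next left factor is attached without any rewriting. *)
Definition admissible (c : nat) (t : xtree) : bool :=
  if (c <= k)%N then
    (rank t <= c)%N ||
    (if t is Op j l _ then (j == lo k) && (core_rank k l <= c)%N else false)
  else (rank t <= c.+1)%N.

Section Expansion.
Variable K : fieldType.
Local Notation M := (free_space K xtree).
Local Notation b := (basis M).
Local Notation A := (tree_alg K m.+1 X).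

(** Beside the weight, the number of leaves is recorded, since it bounds what
   an operation [k.+1] adds to the weight of its right factor. *)
Definition below (C : xtree -> Prop) n w (t : xtree) :=
  [/\ C t, leaves t = n & (wt t < w)%N].

Definition leads (C : xtree -> Prop) t u :=
  C t /\ inspan (below C (leaves t) (wt t)) (u - b t).

(** Leading terms multiply, because the weight of [g l r] increases strictly
   with those of [l] and [r] when the numbers of leaves are fixed. *)
Lemma leads_bilinear (F : M -> M -> M) (g : xtree -> xtree -> xtree) (c : nat -> nat)
    (Cl Cr C : xtree -> Prop) l r u v :
  (forall a x y z, F (a *: x + y) z = a *: F x z + F y z) ->
  (forall a x y z, F z (a *: x + y) = a *: F z x + F z y) ->
  (forall l r, wt (g l r) = wt l + wt r + c (leaves r))%N ->
  (forall l r, leaves (g l r) = leaves l + leaves r)%N ->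
  (forall l r, Cl l -> Cr r -> leads C (g l r) (F (b l) (b r))) ->
  leads Cl l u -> leads Cr r v -> leads C (g l r) (F u v).
Proof.
move=> FPl FPr wg lg FC [Cll ul] [Crr vr].
have [Cg Fg] := FC _ _ Cll Crr; split=> //.
have F0l z : F 0 z = 0 by have := FPl (-1) 0 0 z; rewrite scaleN1r addNr scaleN1r addNr.
have F0r z : F z 0 = 0 by have := FPr (-1) 0 0 z; rewrite scaleN1r addNr scaleN1r addNr.
have FDl x y z : F (x + y) z = F x z + F y z by have := FPl 1 x y z; rewrite !scale1r.
have FDr x y z : F z (x + y) = F z x + F z y by have := FPr 1 x y z; rewrite !scale1r.
have term l' r' : Cl l' -> Cr r' -> leaves l' = leaves l -> leaves r' = leaves r ->
    (wt l' + wt r' < wt l + wt r)%N ->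
    inspan (below C (leaves (g l r)) (wt (g l r))) (F (b l') (b r')).
  move=> Cl' Cr' ll lr lt; have [C' F'] := FC _ _ Cl' Cr'.
  have E : F (b l') (b r') = b (g l' r') + (F (b l') (b r') - b (g l' r')).
    by rewrite addrC subrK.
  rewrite E; apply: inspanD; last first.
    apply: inspan_sub F' => t [Ct lt' wt']; split=> //; first by rewrite lt' !lg ll lr.
    by apply: leq_trans wt' _; rewrite !wg lr; lia.
  by apply: inspan_basis; split=> //; [rewrite !lg ll lr|rewrite !wg lr ltn_add2r].
have -> : F u v - b (g l r)
    = F (b l) (b r) - b (g l r) + (F (b l) (v - b r) + F (u - b l) v).
  have Eu : F u v = F (u - b l) v + F (b l) v by rewrite -FDl subrK.
  have Ev : F (b l) v = F (b l) (v - b r) + F (b l) (b r) by rewrite -FDr subrK.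
  by rewrite Eu Ev addrA [RHS]addrC [RHS]addrA (addrC (F (u - b l) v)).
apply: inspanD => //; apply: inspanD.
  elim: vr => [|a r' w [Cr' lr' wr'] _ IH]; first by rewrite F0r; constructor.
  by rewrite FPr; apply: inspanP => //; apply: term => //; rewrite ltn_add2l.
elim: ul => [|a l' w [Cl' ll' wl'] _ IH]; first by rewrite F0l; constructor.
rewrite FPl; apply: inspanP => //; rewrite -(subrK (b r) v) FDr.
apply: inspanD; last by apply: term => //; rewrite ltn_add2r.
elim: vr => [|a' r' w' [Cr' lr' wr'] _ IH']; first by rewrite F0r; constructor.
by rewrite FPr; apply: inspanP => //; apply: term => //; lia.
Qed.

Lemma basis_leads (C : xtree -> Prop) t : C t -> leads C t (b t).
Proof. by move=> Ct; split=> //; rewrite subrr; constructor. Qed.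

Lemma attach_mul (j : 'I_m.+1) d t : (j < k)%N -> (core_rank k t <= j)%N ->
  mulM (lo j) (b d) (b t) = b (attach (lo j) d t).
Proof.
move=> jk; elim: t => [x _|i l IHl r _] /=.
  by rewrite mul_lt ?graft_basis //; exact: rank_basis.
case: (leqP k i) => [ki cl|ik ij].
  by rewrite -graft_basis mul_graft_gt ?(leq_trans jk) // IHl // graft_basis.
by rewrite mul_lt ?graft_basis //; exact: rank_basis.
Qed.

Lemma weight_attach_left (i : 'I_m.+2) d t : (i < k)%N ->
  wt (attach_left i d t) = (wt d + wt t + 0)%N.
Proof.
move=> ik; have iq : (i == hi k) = false.
  by rewrite -val_eqE /= /bump /= add1n ltn_eqF // ltnW.
have wa s : wt (attach i d s) = (wt d + wt s)%N.
  elim: s => [x|j l IHl r _] /=; first by rewrite iq; lia.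
  by case: leqP => _ /=; rewrite ?iq ?IHl /=; lia.
case: t => [x|j l r] /=; first by rewrite iq; lia.
by case: eqP => _ /=; rewrite ?iq ?wa /=; lia.
Qed.

Lemma leaves_attach_left (i : 'I_m.+2) d t :
  leaves (attach_left i d t) = (leaves d + leaves t)%N.
Proof.
have la s : leaves (attach i d s) = (leaves d + leaves s)%N.
  by elim: s => //= j l IHl r _; case: leqP => //= _; rewrite IHl addnA.
by case: t => //= j l r; case: eqP => //= _; rewrite la addnA.
Qed.

Lemma low_leads (j : 'I_m.+1) c l r : (j < k)%N -> (c <= j)%N ->
  admissible c r ->
  leads (admissible j.+1) (attach_left (lo j) l r) (mulM (lo j) (b l) (b r)).
Proof.
move=> jk cj; rewrite /admissible (leq_trans cj (ltnW jk)) jk.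
case: (boolP (rank r <= c)%N) => [rc _|_ /=].
  have -> : attach_left (lo j) l r = Op (lo j) l r.
    case: r rc => //= i l1 r1 ic; case: eqP => // ik; exfalso.
    by move: ic; rewrite ik /= ltnNge (leq_trans cj (ltnW jk)).
  have rj : (rank r <= lo j)%N by exact: leq_trans cj.
  rewrite (mul_lt _ (rank_basis K rj)) graft_basis.
  by apply: basis_leads; rewrite /= leqnn.
case: r => // i a w /andP[/eqP -> ac] /=; rewrite eqxx -graft_basis.
rewrite mul_graft_gt // attach_mul ?(leq_trans ac) // graft_basis.
by apply: basis_leads; rewrite /= eqxx core_attach //= leqnn orbT.
Qed.

(** The bound is the weight of the product by the operation [k.+1].  It is not
   reached: rewriting the product by [*_k] may add to the weight the leaves of
   one of the two factors of [r], but never those of both. *)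
Lemma mul_lo_weight l r : (rank r <= k.+1)%N ->
  inspan (fun t => wt t < wt l + wt r + leaves r)%N (mulM (lo k) (b l) (b r)).
Proof.
have kq : (lo k == hi k) = false by rewrite -val_eqE /= /bump /= add1n ltn_eqF.
rewrite leq_eqVlt => /orP[|rk]; last first.
  have rk' : (rank r <= lo k)%N by [].
  rewrite (mul_lt _ (rank_basis K rk')) graft_basis; apply: inspan_basis => /=.
  by rewrite kq addn0 -[X in (X < _)%N]addn0 ltn_add2l leaves_gt0.
case: r => //= i r1 r2; rewrite eqSS => /eqP ik.
have -> : i = lo k by apply: val_inj.
have r10 := leaves_gt0 r1; have r20 := leaves_gt0 r2; rewrite kq /= addn0.
rewrite -graft_basis mul_graft_eq; apply: inspanB; apply: inspan_sum => j _.
  rewrite mul_basis.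
  apply: (graft_span (P := fun t => (wt t <= wt l + wt r1 + leaves r1)%N)
                     (Q := eq r2)); last by apply: inspan_basis.
    by move=> t _ tw <- /=; rewrite kq; lia.
  by apply: (inspan_sub _ (tree_mul_span K (hi k) r1 j l)) => t [_ _ tw _].
rewrite mul_basis.
apply: (graft_span (P := eq l) (Q := fun t => (wt t <= wt r1 + wt r2 + leaves r2)%N)).
- by move=> _ t <- tw /=; rewrite kq; lia.
- by apply: inspan_basis.
- by apply: (inspan_sub _ (tree_mul_span K (hi k) r2 j r1)) => t [_ _ tw _].
Qed.

(** Of the two terms of the merged operation, the one with [k.+1] is a normal
   tree and the one with [k] is lighter. *)
Lemma mid_leads c l r : (c <= k)%N -> admissible c r ->
  leads (admissible k.+1) (Op (hi k) l r)
    (mulM (lo k) (b l) (b r) + mulM (hi k) (b l) (b r)).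
Proof.
move=> ck; rewrite /admissible ck ltnn => rc.
have rk : (rank r <= k.+1)%N.
  case: r rc => //= i r1 r2 /orP[ic|/andP[/eqP -> _]] //.
  by rewrite ltnS (leq_trans (ltnW ic)).
have rq : (rank r <= hi k)%N by [].
have r0 := leaves_gt0 r.
split; first by [].
rewrite (mul_lt _ (rank_basis K rq)) graft_basis addrK.
have := mul_lo_weight l rk; rewrite mul_basis => wspan.
apply: inspan_sub (inspan_and wspan (tree_mul_span K (hi k) r (lo k) l)) => t.
move=> [wt_t [lt rt _ _]]; split=> //; last by rewrite /= eqxx mul1n.
by rewrite rt /= geq_max !ltnS leqnSn (leq_trans rk).
Qed.

Lemma high_leads (j : 'I_m.+1) c l r : (k < j)%N -> (c <= j)%N ->
  admissible c r ->
  leads (admissible j.+1) (Op (hi j) l r) (mulM (hi j) (b l) (b r)).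
Proof.
move=> kj cj; rewrite /admissible ltnNge (ltnW kj) /= => rc.
have rj : (rank r <= hi j)%N.
  rewrite /= /bump /= add1n; move: rc; case: leqP => ck; last by move/leq_trans; apply.
  case: r => //= i r1 r2 /orP[ic|/andP[/eqP -> _]] /=; lia.
rewrite (mul_lt _ (rank_basis K rj)) graft_basis.
by apply: basis_leads; rewrite /= /bump /= add1n.
Qed.

Definition gen_basis (y : gen_tree X k) : dyckS A k := b (val y).

Lemma eval_leads t : normal t ->
  leads (admissible (rank t)) (lead t) (eval gen_basis t).
Proof.
elim: t => [y _|j l IHl r IHr /= /and3P[nl nr rj]] /=.
  apply: basis_leads; rewrite /admissible leq0n.
  by case: y => -[x|i l r] //= /and5P[/eqP -> /eqP -> _ _ _]; rewrite eqxx.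
have := IHr nr; have := IHl nl; rewrite /dyckS_op.
case: (ltngtP j k) => jk.
- apply: (leads_bilinear (F := mulM (lo j)) (g := attach_left (lo j)) (c := fun=> 0%N)).
  + exact: mulPl.
  + exact: mulPr.
  + by move=> d t; exact: weight_attach_left.
  + exact: leaves_attach_left.
  + by move=> d t _; exact: low_leads.
- have -> /= : (j == k) = false by rewrite -val_eqE /= gtn_eqF.
  have jq : (hi j == hi k) = false.
    by rewrite -val_eqE /= /bump /= !add1n eqSS gtn_eqF.
  apply: (leads_bilinear (F := mulM (hi j)) (g := Op (hi j)) (c := fun=> 0%N)) => //.
  + exact: mulPl.
  + exact: mulPr.
  + by move=> d t /=; rewrite jq.
  + by move=> d t _; exact: high_leads.
have -> : j = k by apply: val_inj.
rewrite eqxx; apply: (leads_bilinear (g := Op (hi k)) (c := id)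
  (F := fun u v => mulM (lo k) u v + mulM (hi k) u v)) => //.
- by move=> a x y z; rewrite !mulPl scalerDr addrACA.
- by move=> a x y z; rewrite !mulPr scalerDr addrACA.
- by move=> d t /=; rewrite eqxx mul1n.
- by move=> d t _; apply: mid_leads; rewrite -jk.
Qed.

Lemma coefficient_lead t t' : normal t' -> (wt (lead t') <= wt (lead t))%N ->
  coefficient (lead t) (eval gen_basis t' : M) = (t' == t)%:R.
Proof.
move=> /eval_leads[_ span] le.
rewrite -(subrK (b (lead t')) (eval gen_basis t' : M)).
rewrite -[X in coefficient _ (X + _)]scale1r coefficientP.
rewrite (inspan_coefficient0 span) ?mulr0 ?add0r ?coefficient_basis ?(inj_eq lead_inj) //.
by case=> _ _; rewrite ltnNge le.
Qed.

(** Leading trees are pairwise distinct and the other terms are lighter, so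
   reading off the heaviest leading tree kills any linear relation. *)
Lemma eval_independent (u : free_space K stree) :
  inspan (@normal m (gen_tree X k)) u -> evalM gen_basis u = 0 -> u = 0.
Proof.
move=> nu u0.
apply: (triangular_zero (w := fun t => wt (lead t))
  (L := fun t s => coefficient (lead t) (eval gen_basis s : M))) => [t s s_nz le|t].
  apply: coefficient_lead => //; apply: contrapT => ns.
  by move: s_nz; rewrite (inspan_coefficient0 nu ns) eqxx.
have := congr1 (coefficient (lead t) : M -> K) u0.
by rewrite /evalM lextE coefficient_sum /coefficient lext0.
Qed.

End Expansion.
End Leading.

(** * Freeness of the merged algebra *)

Lemma eval_hom (K : fieldType) m Y (A B : dyckAlg K m) (phi : A -> B) (f : Y -> A) t :
  dyck_hom phi -> phi (eval f t) = eval (phi \o f) t.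
Proof.
move=> [_ phiM]; elim: t => //= i l IHl r IHr.
by rewrite phiM IHl IHr.
Qed.

Lemma dyckS_hom (K : fieldType) m (A B : dyckAlg K m.+1) (phi : A -> B) (k : 'I_m.+1) :
  dyck_hom phi -> dyck_hom (phi : dyckS A k -> dyckS B k).
Proof.
move=> [phiP phiM]; split=> // j x y; rewrite /= /dyckS_op.
case: ifP => _; first exact: phiM.
case: ifP => _; last exact: phiM.
by have := phiP 1 (dyck_op (widen_ord (leqnSn m.+1) k) x y)
                  (dyck_op (lift ord0 k) x y); rewrite !scale1r !phiM.
Qed.

Theorem theorem2p2p8 (K : fieldType) (m : nat) (X : Type)
  (D : dyckAlg K m.+1) (iota : X -> D) (hD : dyck_free_over iota)
  (k : 'I_m.+1) : dyck_free (dyckS D k).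
Proof.
have [phi [phi_hom phi_iota _]] := hD (tree_alg K m.+1 X) (fun x => basis _ (Leaf _ x)).
have phi_eval t : normal t -> phi (eval iota t) = basis (free_space K _) t.
  move=> nt; rewrite -(eval_normal K nt) (eval_hom _ _ phi_hom).
  by congr eval; apply: funext.
have evalM_phi d : evalM iota (phi d) = d.
  (* Both sides are endomorphisms of [D] that fix its generators. *)
  have [psi [_ _ psi_unique]] := hD D iota.
  rewrite (psi_unique (fun d => evalM iota (phi d))).
  - by rewrite -(psi_unique id).
  - have [phiP phiM] := phi_hom.
    split=> [a x y|i x y]; first by rewrite phiP evalMP.
    by rewrite phiM evalM_mul.
  - by move=> x; rewrite phi_iota evalM_basis.
exists (gen_tree X k), (gen_val iota); apply: free_of_normal_basis => [d|u nu u0].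
  have [v nv Ev] := evalM_in_normal_span iota (phi d).
  rewrite -(evalM_phi d) Ev.
  apply: (reached_span (C := id) _ _ _ nv) => // t nt.
  exact: normal_reached (leqnn _).
apply: (eval_independent nu).
have phiS := dyckS_hom k phi_hom.
have E t : eval (gen_basis (k := k) K) t = phi (eval (gen_val iota) t).
  rewrite (eval_hom _ _ phiS); congr eval; apply: funext => y /=.
  by rewrite phi_eval //; apply: generator_normal; exact: (valP y).
have [phiP _] := phi_hom.
have phi0 : phi 0 = 0 by have := phiP (-1) 0 0; rewrite scaleN1r addNr scaleN1r addNr.
have EM v : evalM (gen_basis (k := k) K) v = phi (evalM (gen_val iota) v).
  move: v; apply: basis_ind => [|a v w Ev Ew|t]; first by rewrite !raddf0.
    by rewrite !evalMP Ev Ew -phiP.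
  by rewrite !evalM_basis.
by rewrite EM u0.
Qed.
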